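(* The differential equation $\dot x=K_x\,\eta(t,x,y_{\mathrm{ref}})$ (with $K_x>0$) and the difference equation $\chi[k+1]=\chi[k]+\eta(t,\chi[k],y_{\mathrm{ref}})$ have the same equilibrium points, i.e. $$\mathcal E_x(t,y_{\mathrm{ref}})=\mathcal E_\chi(t,y_{\mathrm{ref}})\qquad\forall t\ge0 .$$
   Context: Equilibrium points at instant $t$: $\mathcal E_x(t,y_{\mathrm{ref}}):=\{x\in\mathbb{R}^{d_x}: 0=K_x\,\eta(t,x,y_{\mathrm{ref}})\}$ and $\mathcal E_\chi(t,y_{\mathrm{ref}}):=\{x\in\mathbb{R}^{d_x}: 0=\eta(t,x,y_{\mathrm{ref}})\}$ (equivalently, $x=x+\eta(t,x,y_{\mathrm{ref}})$). Here $h:\mathbb{R}_{\ge0}\times\mathbb{R}^{d_x}\to\mathcal Y\subset\mathbb{R}^{d_y}$ is continuous in $t$ and, in $x$, twice continuously differentiable and surjective; $H:=\partial h/\partial x$; $\sigma(t,\cdot)$ is twice continuously differentiable and strongly convex; $g(t,x)=G(t)x+c(t)\in\mathbb{R}^{d_c}$; $y_{\mathrm{ref}}\in\mathbb{R}^{d_y}$ is the output reference. A barrier function is a twice continuously differentiable $\beta:\mathbb{R}\to\mathbb{R}_{\ge0}$ with $\beta(z)\gg\beta(0)\ge\beta(s)\ge0$ for all $z>0$, $s<0$ (where $\gg$ means ''much larger than''), such that for every $t\ge 0$ and every strongly convex $\sigma(t,\cdot)$ the augmented cost $\rho(t,x):=\sigma(t,x)+\frac12\boldsymbol\beta(g(t,x))^{\top}\boldsymbol\beta(g(t,x))$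 is strongly convex in $x$; $\boldsymbol\beta$ applies $\beta$ elementwise. $r:=[\partial\rho/\partial x]^{\top}$, $R:=\partial r/\partial x$; $A^{\#}_{W}:=W^{-1}A^{\top}(AW^{-1}A^{\top})^{-1}$ for symmetric positive definite $W$ (inverses occurring are assumed to exist, i.e. $H$ has full row rank); and $$\eta(t,x,y_{\mathrm{ref}}):=H(t,x)^{\#}_{R(t,x)}\big(y_{\mathrm{ref}}-h(t,x)\big)-\big(I-H(t,x)^{\#}_{R(t,x)}H(t,x)\big)R(t,x)^{-1}r(t,x).$$ *)

(* Defs.v *)
(* MathComp-Analysis; vectors of R^n are columns 'cV[R]_n, time ranges over
   R and every time-dependent hypothesis is imposed for t >= 0 only. *)
From HB Require Import structures.
From mathcomp Require Export all_boot all_order all_algebra.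
From mathcomp Require Export all_classical all_reals all_analysis.

Set Implicit Arguments.
Unset Strict Implicit.
Unset Printing Implicit Defensive.

Export Order.TTheory GRing.Theory Num.Theory.
Export numFieldNormedType.Exports.
#[global] Open Scope classical_set_scope.
#[global] Open Scope ring_scope.

(* Continuity of the derivative is required direction by direction ('D_v f x is
   'd f x v), which is the usual notion for finite-dimensional V. *)
Definition cont_diff1 (R : realType) (V W : normedModType R) (f : V -> W) :=
  (forall x, differentiable f x) /\ forall v, continuous ('D_v f).

Definition cont_diff2 (R : realType) (V W : normedModType R) (f : V -> W) :=
  cont_diff1 f /\ forall v, cont_diff1 ('D_v f).

(* The library's 'J acts on row vectors and is the transpose of this one. *)
Definition jacobian_mx (R : realType) n m (f : 'cV[R]_n -> 'cV[R]_m)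
    (x : 'cV[R]_n) : 'M[R]_(m, n) :=
  \matrix_(i, j) 'D_(delta_mx j 0) f x i 0.

Definition gradient (R : realType) n (f : 'cV[R]_n -> R)
    (x : 'cV[R]_n) : 'cV[R]_n :=
  \col_j 'D_(delta_mx j 0) f x.

(* The norm is the Euclidean one; the library norm on 'cV is the sup norm. *)
Definition strongly_convex (R : realType) n (f : 'cV[R]_n -> R) :=
  exists2 m : R, 0 < m &
    forall (x y : 'cV[R]_n) (l : R), 0 <= l <= 1 ->
      f (l *: x + (1 - l) *: y) <=
      l * f x + (1 - l) * f y
      - m / 2 * l * (1 - l) * ((x - y)^T *m (x - y)) 0 0.

(* Symmetry is not part of the definition. *)
Definition posdef (R : realType) n (A : 'M[R]_n) :=
  forall v : 'cV[R]_n, v != 0 -> 0 < (v^T *m A *m v) 0 0.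

Definition constraint (R : realType) dx dc (G : R -> 'M[R]_(dc, dx))
    (c : R -> 'cV[R]_dc) (t : R) (x : 'cV[R]_dx) : 'cV[R]_dc :=
  G t *m x + c t.

Definition augmented_cost (R : realType) dx dc (beta : R -> R)
    (g : R -> 'cV[R]_dx -> 'cV[R]_dc) (sigma : R -> 'cV[R]_dx -> R)
    (t : R) (x : 'cV[R]_dx) : R :=
  sigma t x +
  2^-1 * ((map_mx beta (g t x))^T *m map_mx beta (g t x)) 0 0.

(* "beta z much larger than beta 0" has no quantitative content; it is rendered
   by its consequence beta 0 < beta z. (A uniform factor M > 1 would force
   beta 0 = 0 by continuity at 0.) *)
Definition barrier (R : realType) dx dc
    (g : R -> 'cV[R]_dx -> 'cV[R]_dc) (beta : R -> R) :=
  [/\ cont_diff2 (beta : R^o -> R^o),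
      forall z, 0 <= beta z,
      forall z, 0 < z -> beta 0 < beta z,
      forall s, s < 0 -> beta s <= beta 0 &
      forall (sigma : R -> 'cV[R]_dx -> R) t, 0 <= t ->
        cont_diff2 (sigma t : 'cV[R]_dx -> R^o) ->
        strongly_convex (sigma t) ->
        strongly_convex (augmented_cost beta g sigma t)].

Definition weighted_pinv (R : realType) m n (W : 'M[R]_n) (A : 'M[R]_(m, n)) :
    'M[R]_(n, m) :=
  invmx W *m A^T *m invmx (A *m invmx W *m A^T).

Definition eta (R : realType) dx dy (h : R -> 'cV[R]_dx -> 'cV[R]_dy)
    (rho : R -> 'cV[R]_dx -> R) (t : R) (x : 'cV[R]_dx) (yref : 'cV[R]_dy) :
    'cV[R]_dx :=
  let H := jacobian_mx (h t) x in
  let r := gradient (rho t) in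
  let W := jacobian_mx r x in
  let Hpinv := weighted_pinv W H in
  Hpinv *m (yref - h t x) - (1%:M - Hpinv *m H) *m invmx W *m r x.

(* Equilibria of the differential equation x' = K *m f t x yref. *)
Definition equilibria_x (R : realType) dx dy (K : 'M[R]_dx)
    (f : R -> 'cV[R]_dx -> 'cV[R]_dy -> 'cV[R]_dx) (t : R) (yref : 'cV[R]_dy) :
    set 'cV[R]_dx :=
  [set x | 0 = K *m f t x yref].

(* Equilibria of the difference equation chi[k+1] = chi[k] + f t chi[k] yref. *)
Definition equilibria_chi (R : realType) dx dy
    (f : R -> 'cV[R]_dx -> 'cV[R]_dy -> 'cV[R]_dx) (t : R) (yref : 'cV[R]_dy) :
    set 'cV[R]_dx :=
  [set x | 0 = f t x yref].

(* Main.v *)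
Require Import Defs.

(** A positive definite matrix has trivial kernel, so at each fixed [t] and [x] the vector [eta]
    vanishes as soon as its image under [Kx] does, and the converse is linearity. The two
    equilibrium equations are thus equivalent point by point. *)

Lemma posdef_mulmx_eq0 (R : realType) n (A : 'M[R]_n) (v : 'cV[R]_n) :
  posdef A -> A *m v = 0 -> v = 0.
Proof.
move=> Apos Av0; apply/eqP; apply: contraT => /Apos.
(* If [v] were nonzero, the quadratic form at [v] would be positive, yet regrouped as
   [v^T *m (A *m v)] it is zero. *)
by rewrite -mulmxA Av0 mulmx0 mxE ltxx.
Qed.

Theorem lemma7 (R : realType) (dx dy dc : nat)
  (Y : set 'cV[R]_dy) (h : R -> 'cV[R]_dx -> 'cV[R]_dy)
  (sigma : R -> 'cV[R]_dx -> R)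
  (G : R -> 'M[R]_(dc, dx)) (c : R -> 'cV[R]_dc) (beta : R -> R)
  (Kx : 'M[R]_dx) (yref : 'cV[R]_dy)
  (h_cont : forall x : 'cV[R]_dx,
    {within [set t : R | 0 <= t], continuous (fun t : R => h t x)})
  (h_C2 : forall t : R, 0 <= t -> cont_diff2 (h t))
  (h_surj : forall t : R, 0 <= t -> range (h t) = Y)
  (H_full_rank : forall (t : R) (x : 'cV[R]_dx), 0 <= t ->
    row_free (jacobian_mx (h t) x))
  (sigma_C2 : forall t : R, 0 <= t ->
    cont_diff2 (sigma t : 'cV[R]_dx -> R^o))
  (sigma_sconvex : forall t : R, 0 <= t -> strongly_convex (sigma t))
  (beta_barrier : barrier (constraint G c) beta)
  (Kx_pos : posdef Kx) :
  let rho := augmented_cost beta (constraint G c) sigma in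
  forall t : R, 0 <= t ->
    equilibria_x Kx (eta h rho) t yref = equilibria_chi (eta h rho) t yref.
Proof.
move=> rho t _; apply/seteqP; split=> x; rewrite /equilibria_x /equilibria_chi /=.
  (* Only this inclusion uses positivity of [Kx]; both equations carry [0] on the left, hence the
     two [esym]. *)
  by move=> Kx_eta0; apply/esym/(@posdef_mulmx_eq0 _ _ Kx _ Kx_pos)/esym.
by move=> <-; rewrite mulmx0.
Qed.
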